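(* Let $0 \le r \le n/2$ be an integer, let $B = B(n,r) = \bigcup_{i=0}^r S(n,i)$ be the Hamming ball of radius $r$ around $0$ in $\{0,1\}^n$, and let $A$ be the adjacency matrix of the subgraph of the Hamming cube induced by $B$ (two vertices adjacent iff their Hamming distance is $1$). For $0 \le t \le r$ let $\Lambda_t = \{2x - (n-2t) : x \in \mathcal{R}(n-2t, r-t+1)\}$. Then: (1) For each $t = 0,\dots,r$ and each of the $r-t+1$ distinct real numbers $\lambda \in \Lambda_t$, the matrix $A$ has an eigenspace $W_t(\lambda)$ (a subspace of eigenvectors of $A$ with eigenvalue $\lambda$) of dimension $\binom{n}{t} - \binom{n}{t-1}$. (2) A real number $\lambda$ is an eigenvalue of $A$ if and only if $\lambda \in \bigcup_{t=0}^r \Lambda_t$, and its multiplicity as an eigenvalue of $A$ is $m(\lambda) = \sum_{t : \lambda \in \Lambda_t} \left(\binom{n}{t} - \binom{n}{t-1}\right)$, where $\binom{n}{-1} := 0$. (3) Let $f \in W_t(\lambda)$. Then $f$ vanishes on $B(n,t-1) = \bigcup_{i=0}^{t-1} S(n,i)$, and for each $t \le i \le r$ the restriction of $f$ to $S(n,i)$ lies in the $t$-th eigenspace $V_t$ of $S(n,i)$. The restrictions of functions in $W_t(\lambda)$ to $S(n,t)$ span the $t$-th eigenspace $V_t$ of $S(n,t)$, and a function $f \in W_t(\lambda)$ is determined by its restriction to $S(n,t)$.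
   Context: $\{0,1\}^n$ is the Hamming cube with Hamming distance $|x-y|=|\{k: x_k\ne y_k\}|$ and weight $|x|$; points are identified with subsets of $\{1,\dots,n\}$. $S(n,i) = \{x : |x| = i\}$, with inner product $\langle f,g\rangle=\sum_{x\in S(n,i)}f(x)g(x)$ on functions. For $|z|\le i$, $g_z$ is the function on $S(n,i)$ equal to $1$ at $x$ if $z\subseteq x$ and $0$ otherwise; $U_j=\mathrm{span}\{g_z:|z|\le j\}$; the eigenspaces of $S(n,i)$ are $V_0=U_0$ (constants) and $V_j=U_j\cap U_{j-1}^\perp$, $1\le j\le i$. The Krawtchouk polynomial on $\{0,1\}^m$ of degree $k$ is $K^{(m)}_k(x) = \sum_{\ell=0}^k (-1)^\ell \binom{x}{\ell}\binom{m-x}{k-\ell}$ (a polynomial in $x$); its roots are real, distinct and lie in $(0,m)$, and $\mathcal{R}(m,k)$ denotes the set of roots of $K^{(m)}_k$. *)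

(* Defs.v *)
From HB Require Import structures.
From mathcomp Require Import all_boot all_order all_algebra.
From mathcomp Require Import reals.
Unset Strict Implicit. Unset Printing Implicit Defensive.
Import Order.TTheory GRing.Theory Num.Theory.
Local Open Scope ring_scope.

(* Points of {0,1}^n are identified with subsets of 'I_n. *)
Definition hamming (n : nat) (x y : {set 'I_n}) : nat := #|(x :\: y) :|: (y :\: x)|.

Notation ballT n r := {x : {set 'I_n} | (#|x| <= r)%N}.

Section Defs.
Variable R : realType.

Definition adjB (n r : nat) : 'M[R]_#|{: ballT n r}| :=
  \matrix_(i, j) (hamming n (val (@enum_val (ballT n r) _ i)) (val (@enum_val (ballT n r) _ j)) == 1%N)%:R.

Definition vfun (n r : nat) (v : 'rV[R]_#|{: ballT n r}|) (x : {set 'I_n}) : R :=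
  match @insub _ (fun y : {set 'I_n} => (#|y| <= r)%N) (ballT n r) x with
  | Some y => v ord0 (enum_rank y)
  | None => 0
  end.

Definition binomp (p : {poly R}) (l : nat) : {poly R} :=
  (l`!%:R)^-1 *: \prod_(j < l) (p - (j%:R)%:P).

Definition kraw (m k : nat) : {poly R} :=
  \sum_(l < k.+1) ((-1) ^+ l) *: (binomp 'X l * binomp ((m%:R)%:P - 'X) (k - l)).

(* Lambda_t = { 2x - (n-2t) : x root of K^{(n-2t)}_{r-t+1} },
   i.e. lam \in Lambda_t iff (lam + (n-2t))/2 is a root. *)
Definition Lambda (n r t : nat) : pred R :=
  fun lam => root (kraw (n - 2 * t) (r - t).+1) ((lam + (n - 2 * t)%:R) / 2).

(* binom(n,t) - binom(n,t-1), with binom(n,-1) = 0 *)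
Definition bdiff (n t : nat) : nat :=
  if t is t'.+1 then ('C(n, t) - 'C(n, t'))%N else 1%N.

Definition inU (n i j : nat) (h : {set 'I_n} -> R) : Prop :=
  exists c : {set 'I_n} -> R, forall x : {set 'I_n}, #|x| = i ->
    h x = \sum_(z : {set 'I_n} | (#|z| <= j)%N) c z * (z \subset x)%:R.

(* h (restricted to S(n,i)) is orthogonal to U_{j-1} (vacuous for j = 0) *)
Definition perpU (n i j : nat) (h : {set 'I_n} -> R) : Prop :=
  forall z : {set 'I_n}, (#|z| < j)%N ->
    \sum_(x : {set 'I_n} | #|x| == i) h x * (z \subset x)%:R = 0.

(* h restricted to S(n,i) lies in the j-th eigenspace V_j = U_j ∩ U_{j-1}^⊥ *)
Definition inV (n i j : nat) (h : {set 'I_n} -> R) : Prop :=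
  inU n i j h /\ perpU n i j h.

End Defs.

(* Main.v *)
(** Write [m = n - 2t].  If [h] is supported on the level [S(n,t)] and is
    harmonic (the sum of [h] over the sets covering any given set is 0), then
    [F x], the sum of [h] over the subsets of [x], is multiplied by [#|x| - t]
    by the raising operator and by [n - #|x| - t] by the lowering operator, so
    that [d_(#|x|-t) * F x] is an eigenfunction on the ball as soon as [d]
    satisfies a three-term recurrence with a boundary condition at [r - t].
    Normalizing [d] to monic polynomials in the eigenvalue gives
    [p_k = (-1)^k k! K_k^(m)], and the boundary condition says
    [p_(r-t+1) = 0].  The [p_k] have positive Jacobi coefficients, so
    [p_(r-t+1)] has [r - t + 1] distinct real roots, by interlacing.
    Harmonic functions on [S(n,t)] form a space of dimension
    [C(n,t) - C(n,t-1)] because raising is injective below the middle level.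
    For a fixed eigenvalue the spaces for different [t] are independent, being
    triangular with respect to the levels; the dimensions of all these spaces
    add up to [#|B|], so there are no other eigenvectors. *)
Require Import Defs.
From HB Require Import structures.
From mathcomp Require Import all_boot all_order all_algebra.
From mathcomp Require Import reals polyrcf ring lra zify.
Set Implicit Arguments.
Unset Strict Implicit.
Unset Printing Implicit Defensive.
Import Order.TTheory GRing.Theory Num.Theory.
Local Open Scope ring_scope.

(** * Jacobi and Krawtchouk polynomials *)

Section Jacobi.
Variables (R : rcfType) (b : nat -> R).

Fixpoint jacobi (k : nat) : {poly R} :=
  if k is k1.+1 then
    if k1 is k2.+1 then 'X * jacobi k1 - b k1 *: jacobi k2 else 'X
  else 1.

Lemma jacobiSS k : jacobi k.+2 = 'X * jacobi k.+1 - b k.+1 *: jacobi k.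
Proof. by []. Qed.

Lemma size_jacobi k : size (jacobi k) = k.+1.
Proof.
suff [] : size (jacobi k) = k.+1 /\ size (jacobi k.+1) = k.+2 by [].
elim: k => [|k [IH1 IH2]]; first by rewrite size_poly1 size_polyX.
split=> //; rewrite jacobiSS size_polyDl mulrC size_mulX -?size_poly_eq0 IH2 //.
by rewrite size_polyN (leq_ltn_trans (size_scale_leq _ _)) // IH1.
Qed.

Lemma monic_jacobi k : jacobi k \is monic.
Proof.
suff [] : jacobi k \is monic /\ jacobi k.+1 \is monic by [].
elim: k => [|k [IH1 IH2]]; first by rewrite monic1 monicX.
split=> //; rewrite monicE jacobiSS lead_coefDl.
  by rewrite mulrC lead_coefMX (monicP IH2).
rewrite mulrC size_mulX -?size_poly_eq0 size_jacobi //.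
by rewrite size_polyN (leq_ltn_trans (size_scale_leq _ _)) // size_jacobi.
Qed.

End Jacobi.

(** The sign at [- x] comes from applying the bound at plus infinity to [(-1)^k q(-X)], which has
    leading coefficient 1 again. *)
Lemma monic_far_sign (R : rcfType) (q : {poly R}) k : q \is monic -> size q = k.+1 ->
  exists M, forall x, M <= x -> 0 < q.[x] /\ 0 < (-1) ^+ k * q.[- x].
Proof.
move=> qm qs.
have [|M1 h1] := @poly_pinfty_gt_lc _ q; rewrite ?(monicP qm) ?ltr01 //.
pose q' := (-1) ^+ k *: (q \Po - 'X).
have lq' : lead_coef q' = 1.
  rewrite lead_coefZ lead_coef_comp ?size_polyN ?size_polyX //.
  by rewrite lead_coefN lead_coefX qs (monicP qm) mul1r -expr2 sqrr_sign.
have [|M2 h2] := @poly_pinfty_gt_lc _ q'; rewrite ?lq' ?ltr01 //.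
exists (Num.max M1 M2) => x; rewrite ge_max => /andP[x1 x2].
rewrite (monicP qm) in h1; rewrite lq' in h2.
split; first exact: lt_le_trans ltr01 (h1 _ x1).
have := h2 _ x2; rewrite hornerZ horner_comp hornerN hornerX.
exact: lt_le_trans ltr01.
Qed.

(** Exactly the [k - i] factors of index at least [i] are negative. *)
Lemma prod_sub_sign (R : realDomainType) (x : nat -> R) (y : R) i k : (i <= k)%N ->
    (forall j, (j < i)%N -> x j < y) ->
    (forall j, (i <= j < k)%N -> y < x j) ->
  0 < (-1) ^+ (k - i) * \prod_(j < k) (y - x j).
Proof.
move=> ik xl xr; rewrite -(big_mkord xpredT (fun j => y - x j)).
rewrite (@big_cat_nat _ _ _ i) //= mulrCA mulr_gt0 //.
  rewrite big_nat; apply: prodr_gt0 => j /andP[_ ji]; rewrite subr_gt0; exact: xl.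
rewrite -prodr_const_nat -big_split big_nat; apply: prodr_gt0 => j ij.
by rewrite /= mulN1r opprB subr_gt0 xr.
Qed.

(** The last conclusion strengthens the induction: [p_(k-1)] alternates in sign along the roots of
    [p_k]. By the recurrence [p_(k+1)] alternates there too, and the intermediate value theorem
    yields a root in each gap and one beyond each end. *)
Lemma jacobi_interlace (R : rcfType) (b : nat -> R) k :
    (forall i, (0 < i < k)%N -> 0 < b i) ->
  exists x : nat -> R,
    [/\ forall i j, (i < j)%N -> (j < k)%N -> x i < x j,
        jacobi b k = \prod_(i < k) ('X - (x i)%:P) &
        forall i, (i < k)%N -> 0 < (-1) ^+ (k - i).+1 * (jacobi b k.-1).[x i]].
Proof.
elim: k => [|k IH] hb.
  by exists (fun=> 0); split=> //; rewrite big_ord0.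
have [|x [xlt pE psgn]] := IH; first by move=> i ?; apply: hb; lia.
have [M hM] := monic_far_sign (monic_jacobi b k.+1) (size_jacobi b k.+1).
(* [N] is at least [M] and exceeds the modulus of every root, so [- N] and [N] can serve as outer
   end points. *)
pose N := `|M| + \sum_(i < k) `|x i| + 1.
have Mpos : M <= N.
  rewrite /N -addrA ler_wpDr ?ler_norm // addr_ge0 //; exact: sumr_ge0.
have xN i : (i < k)%N -> `|x i| < N.
  move=> ik; rewrite /N (bigD1 (Ordinal ik)) //=.
  have : 0 <= \sum_(j < k | j != Ordinal ik) `|x j| by exact: sumr_ge0.
  have := normr_ge0 M; lra.
have N0 : 0 < N.
  by rewrite /N ltr_wpDl // addr_ge0 //; exact: sumr_ge0.
(* [a] lists [- N], the [k] roots and [N]: along these [k + 2] points [p_(k+1)] changes sign [k + 1]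
   times. *)
pose a i := if i is j.+1 then if (j < k)%N then x j else N else - N.
have aS i j : (i < j)%N -> (j <= k.+1)%N -> a i < a j.
  case: j => // j ij jk; case: i ij => [|i] ij; rewrite /a.
    by case: ifP => // [/xN|_]; [rewrite ltr_norml => /andP[] | lra].
  have -> : (i < k)%N by lia.
  case: ifP => [jk'|_]; first exact: xlt.
  have /xN : (i < k)%N by lia.
  by rewrite ltr_norml => /andP[].
set q := jacobi b k.+1.
(* At a root of [p_k] the recurrence leaves only [- b_k p_(k-1)], whose sign is known by
   induction. *)
have qx i : (i < k)%N -> 0 < (-1) ^+ (k - i) * q.[x i].
  move=> ik; have := psgn _ ik; rewrite /q.
  case: k ik pE hb {IH xlt psgn hM a aS Mpos xN N N0 q} => // k ik pE hb.
  rewrite jacobiSS hornerD hornerN hornerZ hornerM hornerX.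
  have -> : (jacobi b k.+1).[x i] = 0.
    by rewrite pE horner_prod (bigD1 (Ordinal ik)) //= hornerXsubC subrr mul0r.
  rewrite mulr0 add0r /= exprS mulN1r mulNr -mulrN => h.
  by rewrite -mulrN mulrCA mulr_gt0 // hb //; lia.
have qa i : (i <= k.+1)%N -> 0 < (-1) ^+ (k.+1 - i) * q.[a i].
  case: i => [|i] ik /=; first by rewrite subn0; exact: (hM N Mpos).2.
  case: ifP => ik'; first by rewrite subSS; exact: qx.
  have -> : i = k by lia.
  by rewrite subnn mul1r; exact: (hM N Mpos).1.
(* The bound on [i] sits inside the sigma type so that [y] becomes a total function on [nat]. *)
have ivt i : {y | (i <= k)%N -> [/\ a i < y, y < a i.+1 & root q y]}.
  case: (leqP i k) => ik; last by exists 0.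
  have [||y] := @poly_ivtoo _ q (a i) (a i.+1); first by rewrite ltW ?aS.
    have h1 := qa i (leqW ik); have h2 := qa i.+1 ik.
    rewrite subSn // exprS mulN1r mulNr in h1; rewrite subSS in h2.
    have := mulr_gt0 h1 h2; rewrite mulNr mulrACA -expr2 sqrr_sign mul1r.
    by rewrite oppr_gt0.
  by rewrite in_itv /= => /andP[? ?] ?; exists y.
pose y i := sval (ivt i).
have yP i : (i <= k)%N -> [/\ a i < y i, y i < a i.+1 & root q (y i)] := svalP (ivt i).
have aW i j : (i <= j)%N -> (j <= k.+1)%N -> a i <= a j.
  by rewrite leq_eqVlt => /predU1P[->//|ij] jk; rewrite ltW ?aS.
have ylt i j : (i < j)%N -> (j < k.+1)%N -> y i < y j.
  move=> ij jk; have [|_ h1 _] := yP i; first lia.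
  have [//|h2 _ _] := yP j.
  by apply: lt_trans h1 (le_lt_trans _ h2); apply: aW => //; lia.
exists y; split=> //.
- pose rs := [seq y i | i <- iota 0 k.+1].
  rewrite -/q (@all_roots_prod_XsubC _ q rs).
  + rewrite (monicP (monic_jacobi _ _)) scale1r /rs big_map.
    by rewrite -[iota _ _]/(index_iota 0 k.+1) big_mkord.
  + by rewrite size_map size_iota size_jacobi.
  + apply/allP => _ /mapP[i + ->]; rewrite mem_iota => /andP[_ ik].
    by have [|_ _] := yP i.
  + rewrite uniq_rootsE map_inj_in_uniq ?iota_uniq // => i j.
    rewrite !mem_iota => /andP[_ ik] /andP[_ jk] yij.
    by case: (ltngtP i j) => // ij; [have := ylt i j ij jk | have := ylt j i ij ik];
      rewrite yij ltxx.
- move=> i ik; rewrite /= pE horner_prod.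
  under eq_bigr do rewrite hornerXsubC.
  (* Two signs cancel, leaving [(-1)^(k-i)]: the new root [y i] lies between [x (i-1)] and [x i], so
     [k - i] old roots are above it. *)
  rewrite subSn // !exprS !mulN1r opprK.
  have [//|h1 h2 _] := yP i.
  apply: prod_sub_sign => // j jk.
    have : a j.+1 <= a i by apply: aW; lia.
    have jk' : (j < k)%N by lia.
    by rewrite {1}/a jk' => h; apply: le_lt_trans h h1.
  have : a i.+1 <= a j.+1 by apply: aW; lia.
  have jk' : (j < k)%N by lia.
  rewrite {2}/a jk' => h; exact: lt_le_trans h2 h.
Qed.

(** * The three-term recurrence as a convolution identity *)

Section Convolution.
Variables (R : comNzRingType) (x y : R) (a c : nat -> R).
Hypothesis aS : forall l, l.+1%:R * a l.+1 = (l%:R - x) * a l.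
Hypothesis cS : forall j, j.+1%:R * c j.+1 = (y - j%:R) * c j.

Let T k := \sum_(l < k.+1) a l * c (k - l)%N.

Lemma convol_shiftl k :
  \sum_(l < k.+2) l%:R * (a l * c (k.+1 - l)%N) = \sum_(l < k.+1) (l%:R - x) * (a l * c (k - l)%N).
Proof.
rewrite big_ord_recl /= mul0r add0r; apply: eq_bigr => l _.
by rewrite !mulrA aS subSS.
Qed.

Lemma convol_shiftr k :
  \sum_(l < k.+2) (k.+1 - l)%:R * (a l * c (k.+1 - l)%N) =
  \sum_(l < k.+1) (y - (k - l)%:R) * (a l * c (k - l)%N).
Proof.
rewrite big_ord_recr /= subnn mul0r addr0; apply: eq_bigr => l _.
by rewrite mulrCA subSn -1?ltnS // cS mulrCA.
Qed.

(* With [a], [c] the coefficients of [(1-z)^x] and [(1+z)^y], this is the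
   coefficientwise form of [(1 - z^2) G' = (y - x - (x + y) z) G]. *)
Lemma convol_rec k :
  k.+2%:R * T k.+2 = (y - x) * T k.+1 - (x + y - k%:R) * T k.
Proof.
(* [k + 2] is split as [l + (k + 2 - l)], one part for each factor of the product. *)
have -> : k.+2%:R * T k.+2 = \sum_(l < k.+2) (l%:R - x) * (a l * c (k.+1 - l)%N)
    + \sum_(l < k.+2) (y - (k.+1 - l)%:R) * (a l * c (k.+1 - l)%N).
  rewrite -convol_shiftl -convol_shiftr -big_split mulr_sumr; apply: eq_bigr => l _ /=.
  by rewrite -mulrDl -natrD subnKC // -ltnS.
(* Writing [- (x + y - k)] as [(l - x) - (y - (k - l))] lets both shifts be applied backwards, so
   that all sums run over the terms of [T k.+1]. *)
have -> : (y - x) * T k.+1 - (x + y - k%:R) * T k = (y - x) * T k.+1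
   + \sum_(l < k.+2) l%:R * (a l * c (k.+1 - l)%N)
   - \sum_(l < k.+2) (k.+1 - l)%:R * (a l * c (k.+1 - l)%N).
  rewrite convol_shiftl convol_shiftr -[RHS]addrA -sumrB !mulr_sumr -sumrN; congr (_ + _).
  apply: eq_bigr => l _; rewrite natrB -1?ltnS //; ring.
rewrite mulr_sumr -!big_split -sumrB /=; apply: eq_bigr => l _; ring.
Qed.

End Convolution.

Section Krawtchouk.
Variable R : realType.

Definition gbin (x : R) (l : nat) : R := (l`!%:R)^-1 * \prod_(j < l) (x - j%:R).

Lemma gbinS x l : l.+1%:R * gbin x l.+1 = (x - l%:R) * gbin x l.
Proof.
rewrite /gbin big_ord_recr /= factS natrM.
have h1 : (l.+1)%:R != 0 :> R by rewrite pnatr_eq0.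
have h2 : (l`!)%:R != 0 :> R by rewrite pnatr_eq0 -lt0n fact_gt0.
by field; rewrite h2 nat1r.
Qed.

Lemma horner_kraw m k x :
  (kraw R m k).[x] = \sum_(l < k.+1) (-1) ^+ l * gbin x l * gbin (m%:R - x) (k - l)%N.
Proof.
have binompE p l : (binomp R p l).[x] = gbin p.[x] l.
  rewrite /binomp hornerZ horner_prod; congr (_ * _).
  by apply: eq_bigr => j _; rewrite !hornerE.
rewrite /kraw horner_sum; apply: eq_bigr => l _.
by rewrite hornerZ hornerM !binompE hornerD hornerN hornerC hornerX mulrA.
Qed.

Definition krawb (m k : nat) : R := k%:R * (m%:R - k%:R + 1).

(** With [y = m - x] the convolution recurrence has [y - x = - lam] and [x + y = m]; multiplied by
    [(-1)^k (k+1)!] it is the Jacobi recurrence with coefficients [krawb m]. *)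
Lemma jacobi_kraw m k lam :
  (jacobi (krawb m) k).[lam] = (-1) ^+ k * k`!%:R * (kraw R m k).[(lam + m%:R) / 2].
Proof.
set x := _ / 2.
suff [] : (jacobi (krawb m) k).[lam] = (-1) ^+ k * k`!%:R * (kraw R m k).[x] /\
  (jacobi (krawb m) k.+1).[lam] = (-1) ^+ k.+1 * k.+1`!%:R * (kraw R m k.+1).[x] by [].
have lamE : lam = 2 * x - m%:R by rewrite /x; field.
elim: k => [|k [IH1 IH2]].
  rewrite !horner_kraw !big_ord_recl !big_ord0 /gbin !big_ord_recl !big_ord0.
  rewrite /= hornerC hornerX lamE /bump /= !subn0 ?subnn (_ : 1`! = 1%N) // fact0.
  by split; field.
split=> //; rewrite jacobiSS hornerD hornerN hornerZ hornerM hornerX IH1 IH2.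
have aS l : l.+1%:R * ((-1) ^+ l.+1 * gbin x l.+1) = (l%:R - x) * ((-1) ^+ l * gbin x l).
  by rewrite mulrCA gbinS exprS; ring.
have := convol_rec aS (gbinS (m%:R - x)) k.
rewrite -!horner_kraw [k.+2`!]factS natrM /krawb => T2.
have -> : (-1) ^+ k.+2 * (k.+2%:R * k.+1`!%:R) * (kraw R m k.+2).[x] =
  (-1) ^+ k.+2 * k.+1`!%:R * (k.+2%:R * (kraw R m k.+2).[x]) by ring.
rewrite T2 {1}lamE factS natrM !exprS; ring.
Qed.

(** The bound [k <= m + 1] makes [krawb m i = i (m - i + 1)] positive for [0 < i < k], as
    interlacing requires. *)
Lemma kraw_roots (m k : nat) : (k <= m.+1)%N ->
  exists2 s : seq R, uniq s /\ size s = k &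
    forall lam, lam \in s -> root (kraw R m k) ((lam + m%:R) / 2).
Proof.
move=> km; have [|x [xlt pE _]] := @jacobi_interlace R (krawb m) k.
  move=> i /andP[i0 ik]; apply: mulr_gt0; first by rewrite ltr0n.
  have : (i%:R : R) <= m%:R by rewrite ler_nat; lia.
  by lra.
exists [seq x i | i <- iota 0 k].
  rewrite size_map size_iota map_inj_in_uniq ?iota_uniq // => i j.
  rewrite !mem_iota => /andP[_ ik] /andP[_ jk] xij.
  by case: (ltngtP i j) => // ij; [have := xlt i j ij jk | have := xlt j i ij ik];
    rewrite xij ltxx.
move=> _ /mapP[i + ->]; rewrite mem_iota => /andP[_ ik].
have : (jacobi (krawb m) k).[x i] = 0.
  by rewrite pE horner_prod (bigD1 (Ordinal ik)) //= hornerXsubC subrr mul0r.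
move/eqP; rewrite jacobi_kraw !mulf_eq0 signr_eq0 pnatr_eq0 gtn_eqF ?fact_gt0 //.
Qed.

End Krawtchouk.

(** * Multiplicities for diagonalizable matrices *)

Section Diagonalizable.
Variables (F : fieldType) (n : nat).
Implicit Types (A P : 'M[F]_n) (d : 'rV[F]_n).

Lemma card_ord_row0 d : (#|[pred i | d 0%R i != 0%R]| + #|[pred i | d 0%R i == 0%R]| = n)%N.
Proof.
rewrite -[RHS]card_ord -(cardC [pred i | d 0 i != 0]); congr (_ + _)%N.
by apply: eq_card => i; rewrite !inE negbK.
Qed.

Lemma rank_diag_mx d : \rank (diag_mx d) = #|[pred i | d 0 i != 0]|.
Proof.
have le (e : 'rV[F]_n) : (\rank (diag_mx e) <= #|[pred i | e 0%R i != 0%R]|)%N.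
  have -> : diag_mx e = \sum_(i | e 0 i != 0) e 0 i *: delta_mx i i.
    rewrite diag_mx_sum_delta (bigID (fun i => e 0 i != 0)) /= addrC big1 ?add0r //.
    by move=> i; rewrite negbK => /eqP ->; rewrite scale0r.
  rewrite -sum1_card; elim/big_ind2: _ => [|B k C l Bk Cl|i _]; first by rewrite mxrank0.
    exact: leq_trans (mxrank_add _ _) (leq_add Bk Cl).
  by rewrite (leq_trans (mxrank_scale _ _)) // mxrank_delta.
apply/eqP; rewrite eqn_leq le /=.
(* The complementary diagonal [f] makes [diag_mx d + diag_mx f] invertible, so subadditivity of the
   rank turns the upper bound for [f] into the lower bound for [d]. *)
pose f : 'rV[F]_n := \row_i (d 0 i == 0)%:R.
have := le f; rewrite (eq_card (_ : _ =i [pred i | d 0 i == 0])); last first.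
  by move=> i; rewrite !inE !mxE; case: (d _ i == 0); rewrite /= ?eqxx ?oner_eq0.
move=> lef.
rewrite -(leq_add2r #|[pred i | d 0%R i == 0%R]|) card_ord_row0.
apply: leq_trans (leq_add (leqnn _) lef).
apply: leq_trans (mxrank_add _ _).
rewrite -linearD mxrank_unit // unitmxE det_diag unitfE.
apply/prodf_neq0 => i _; rewrite !mxE.
case: (eqVneq (d 0 i) 0) => [->|]; first by rewrite add0r oner_eq0.
by rewrite addr0.
Qed.

Lemma char_poly_simmx A B P : P \in unitmx -> P *m A = B *m P -> char_poly A = char_poly B.
Proof.
move=> Pu PAB; rewrite /char_poly.
have Pu' : \det (map_mx polyC P) != 0.
  by rewrite det_map_mx polyC_eq0 -unitfE -unitmxE.
apply: (mulfI Pu'); rewrite [RHS]mulrC -!det_mulmx; congr (\det _).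
rewrite /char_poly_mx mulmxBl mulmxBr -!map_mxM PAB; congr (_ - _).
exact: scalar_mxC.
Qed.

Lemma mxrank_eigenspace_simmx A B P a : P \in unitmx -> P *m A = B *m P ->
  \rank (eigenspace A a) = \rank (eigenspace B a).
Proof.
move=> Pu PAB; rewrite !mxrank_ker; congr (_ - _)%N.
rewrite -(eqmxMfull (A - a%:M) (_ : row_full P)) ?row_full_unit //.
rewrite -[RHS](mxrankMfree _ (_ : row_free P)) ?row_free_unit //.
by rewrite mulmxBr mulmxBl PAB scalar_mxC.
Qed.

(** Both sides are invariant under similarity, and for a diagonal matrix both count the diagonal
    entries equal to [a]. *)
Lemma mup_char_poly_diagonalizable A a : diagonalizable A ->
  mup a (char_poly A) = \rank (eigenspace A a).
Proof.
case=> P Pu /diagonalizable_forPex[d /(simmxP Pu) PAd].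
rewrite (mxrank_eigenspace_simmx _ Pu PAd) (char_poly_simmx Pu PAd).
rewrite char_poly_trig ?diag_mx_is_trig //.
rewrite -big_enum /= -(big_map (fun i => diag_mx d i i) xpredT (fun x => 'X - x%:P)) mu_prod_XsubC.
rewrite mxrank_ker -diag_const_mx -linearB rank_diag_mx.
rewrite -[X in (X - _)%N](card_ord_row0 (d - const_mx a)) addKn.
rewrite count_map cardE [in RHS]/enum_mem -enumT size_filter; apply: eq_count => i /=.
by rewrite inE !mxE eqxx mulr1n subr_eq0.
Qed.

Lemma mxrank_sum_eigenspace A (rs : seq F) : uniq rs ->
  \rank (\sum_(i < size rs) eigenspace A rs`_i)%MS =
  (\sum_(i < size rs) \rank (eigenspace A rs`_i))%N.
Proof.
move=> rsU; apply/mxdirectP; apply: mxdirect_sum_eigenspace => i j _ _ /eqP.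
by rewrite nth_uniq // => /eqP/val_inj.
Qed.

Lemma leq_sum_mxrank_eigenspace A (rs : seq F) : uniq rs ->
  (\sum_(a <- rs) \rank (eigenspace A a) <= n)%N.
Proof. by move=> rsU; rewrite (big_nth 0) big_mkord -mxrank_sum_eigenspace ?rank_leq_col. Qed.

Lemma diagonalizable_sum_mxrank A (rs : seq F) : uniq rs ->
  (n <= \sum_(a <- rs) \rank (eigenspace A a))%N -> diagonalizable A.
Proof.
move=> rsU; rewrite (big_nth 0) big_mkord -mxrank_sum_eigenspace // => nle.
apply/diagonalizablePeigen; exists rs => //; rewrite (big_nth 0) big_mkord.
by apply/eqmxP; rewrite submx1 sub1mx -col_leq_rank.
Qed.

(* The lower bounds [b] add up to [n], which forces all of them to be equalities. *)
Lemma eigen_count A (T : finType) (L : T -> pred F) (s : T -> seq F) (b : T -> nat) :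
    (forall t, uniq (s t)) -> (forall t a, a \in s t -> a \in L t) ->
    (n <= \sum_t size (s t) * b t)%N ->
    (forall a, \sum_(t | a \in L t) b t <= \rank (eigenspace A a))%N ->
  diagonalizable A /\ forall a, \rank (eigenspace A a) = (\sum_(t | a \in L t) b t)%N.
Proof.
move=> sU sL nle ble.
(* [a0] is put into the list explicitly, since it need not occur in any [s t]. *)
have key a0 : exists rs : seq F, [/\ a0 \in rs, uniq rs &
    (n <= \sum_(a <- rs) \sum_(t | a \in L t) b t)%N].
  pose rs := undup (a0 :: flatten [seq s t | t : T]).
  exists rs; split; rewrite ?undup_uniq ?mem_undup ?mem_head //.
  apply: (leq_trans nle); rewrite (exchange_big_dep xpredT) //=; apply: leq_sum => t _.
  rewrite big_const_seq iter_addn_0 mulnC leq_mul2l -size_filter uniq_leq_size ?orbT //.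
  move=> a ast; rewrite mem_filter sL //= mem_undup inE; apply/orP; right.
  by apply/flatten_mapP; exists t; rewrite ?mem_enum.
split=> [|a0].
  have [rs [_ rsU h]] := key 0; apply: (diagonalizable_sum_mxrank rsU).
  by apply: leq_trans h _; apply: leq_sum => a _.
have [rs [a0rs rsU h]] := key a0.
(* After [a0] is split off, the remaining ranks are at least the remaining bounds and can be
   cancelled. *)
have := leq_trans (leq_sum_mxrank_eigenspace A rsU) h.
rewrite (bigD1_seq a0) //= [X in (_ <= X)%N -> _](bigD1_seq a0) //= => le.
apply/eqP; rewrite eqn_leq ble andbT.
have hle : (\sum_(a <- rs | a != a0) \sum_(t | a \in L t) b t <=
        \sum_(a <- rs | a != a0) \rank (eigenspace A a))%N by apply: leq_sum.
by have := leq_trans le (leq_add (leqnn _) hle); rewrite leq_add2r.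
Qed.

End Diagonalizable.

(** * Raising and lowering operators on the cube *)

Section SetFunctions.
Variables (R : realFieldType) (n : nat).
Implicit Types (f g h : {set 'I_n} -> R) (x y z w : {set 'I_n}) (a b : 'I_n).

Definition up f x : R := \sum_(a in x) f (x :\ a).
Definition dn f x : R := \sum_(a | a \notin x) f (a |: x).
Definition ssum f x : R := \sum_(z : {set 'I_n} | z \subset x) f z.
Definition supp t f := forall x, #|x| != t -> f x = 0.

Lemma reindex_setU1 a (P : pred {set 'I_n}) f :
  \sum_(x | P x && (a \in x)) f x = \sum_(x | P (a |: x) && (a \notin x)) f (a |: x).
Proof.
rewrite (reindex_onto (fun x => a |: x) (fun x => x :\ a)) /=; last first.
  by move=> x /andP[_ ax]; rewrite setD1K.
apply: eq_bigl => x; rewrite setU11 andbT; case: (boolP (a \in x)) => ax; last first.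
  by rewrite setU1K // eqxx.
case: eqP => [e|]; last by rewrite !andbF.
by move: ax; rewrite -e !inE eqxx.
Qed.

(** Both sides sum over edges of the cube, indexed by the upper end point on the left and the lower
    one on the right. *)
Lemma exchange_setU1 (G : {set 'I_n} -> 'I_n -> R) (P : {set 'I_n} -> 'I_n -> bool) :
  \sum_(x : {set 'I_n}) \sum_(a | (a \in x) && P x a) G x a =
  \sum_(x : {set 'I_n}) \sum_(a | (a \notin x) && P (a |: x) a) G (a |: x) a.
Proof.
rewrite (exchange_big_dep xpredT) // [RHS](exchange_big_dep xpredT) //=.
apply: eq_bigr => a _; under eq_bigl do rewrite andbC.
by rewrite reindex_setU1; apply: eq_bigl => x; rewrite andbC.
Qed.

Lemma sum_notin_const x (c : R) : \sum_(a | a \notin x) c = (n%:R - #|x|%:R) * c.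
Proof.
rewrite sumr_const -[in n%:R](card_ord n) -(cardC (mem x)) natrD.
by rewrite [X in X - _]addrC addrK mulr_natl.
Qed.

Lemma sum_in_const x (c : R) : \sum_(a in x) c = #|x|%:R * c.
Proof. by rewrite sumr_const mulr_natl. Qed.

Lemma sum_sub_notin_const x z (c : R) : z \subset x ->
  \sum_(a in x | a \notin z) c = (#|x|%:R - #|z|%:R) * c.
Proof.
move=> zx; transitivity (\sum_(a in x :\: z) c).
  by apply: eq_bigl => a; rewrite inE andbC.
by rewrite sum_in_const cardsD (setIidPr zx) natrB ?subset_leq_card.
Qed.

Lemma adjoint_up_dn f g : \sum_x f x * up g x = \sum_x dn f x * g x.
Proof.
under eq_bigr do rewrite mulr_sumr; under [RHS]eq_bigr do rewrite mulr_suml.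
have /= := exchange_setU1 (fun x a => f x * g (x :\ a)) (fun _ _ => true).
under eq_bigr do under eq_bigl do rewrite andbT.
move=> ->; apply: eq_bigr => x _; apply: eq_big => [a|a]; first by rewrite andbT.
by rewrite andbT => ax; rewrite setU1K.
Qed.

(** Removing one element and adding a different one commute, so only the round trips to [x] differ:
    [n - #|x|] through the level above, [#|x|] through the level below. *)
Lemma dn_up f x : dn (up f) x = up (dn f) x + (n%:R - 2 * #|x|%:R) * f x.
Proof.
have -> : dn (up f) x = (n%:R - #|x|%:R) * f x +
    \sum_(a | a \notin x) \sum_(b in x) f ((a |: x) :\ b).
  rewrite -sum_notin_const -big_split; apply: eq_bigr => a ax.
  by rewrite /up big_setU1 //= setU1K.
have -> : up (dn f) x = #|x|%:R * f x +
    \sum_(b in x) \sum_(a | a \notin x) f (a |: (x :\ b)).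
  rewrite -sum_in_const -big_split; apply: eq_bigr => b bx.
  rewrite /dn (bigD1 b) /= ?setD11 // setD1K //; congr (_ + _).
  by apply: eq_bigl => a; rewrite !inE negb_and negbK;
    case: (eqVneq a b) => [->|_]; rewrite ?bx ?andbT.
rewrite [X in _ = _ + X + _]exchange_big /=.
rewrite (_ : \sum_(a | a \notin x) _ = \sum_(a | a \notin x) \sum_(b in x) f (a |: x :\ b)).
  by ring.
apply: eq_bigr => a ax; apply: eq_bigr => b bx; congr f.
by apply/setP => c; rewrite !inE; case: (eqVneq c a) => // ->; case: eqVneq => // e;
  rewrite e bx in ax.
Qed.

(* [|up f|^2 = |dn f|^2 + (n - 2j) |f|^2] when [f] lives on level [j]. *)
Lemma up_inj j f : (2 * j < n)%N -> supp j f -> (forall x, up f x = 0) -> forall x, f x = 0.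
Proof.
move=> jn fj uf.
have : \sum_x f x * dn (up f) x = 0.
  by apply: big1 => x _; rewrite /dn big1 ?mulr0.
under eq_bigr do rewrite dn_up mulrDr.
rewrite big_split /= adjoint_up_dn => e.
have fE x : f x * ((n%:R - 2 * #|x|%:R) * f x) = (n%:R - 2 * j%:R) * (f x ^+ 2).
  case: (eqVneq #|x| j) => [->|/fj ->]; ring.
move: e; under [X in _ + X]eq_bigr do rewrite fE.
under [X in X + _]eq_bigr do rewrite -expr2.
rewrite -mulr_sumr => /eqP; rewrite paddr_eq0; last 2 first.
- by apply: sumr_ge0 => x _; exact: sqr_ge0.
- apply: mulr_ge0; last by apply: sumr_ge0 => x _; exact: sqr_ge0.
  by rewrite -natrM subr_ge0 ler_nat ltnW.
case/andP => _; rewrite mulf_eq0 -natrM subr_eq0 eqr_nat (gtn_eqF jn) /=.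
rewrite psumr_eq0 => [/allP h x|x _]; last exact: sqr_ge0.
by have := h x (mem_index_enum x); rewrite sqrf_eq0 => /eqP.
Qed.

(** A [t]-subset of [x] survives the removal of exactly [#|x| - t] elements of [x]. *)
Lemma up_ssum t h x : supp t h -> up (ssum h) x = (#|x|%:R - t%:R) * ssum h x.
Proof.
move=> ht; rewrite /up /ssum mulr_sumr.
under eq_bigr do under eq_bigl do rewrite subsetD1.
rewrite (exchange_big_dep (fun z => z \subset x)) /=; last by move=> ? ? _ /andP[].
apply: eq_bigr => z zx; transitivity (\sum_(a in x | a \notin z) h z).
  by apply: eq_bigl => a; rewrite zx.
rewrite sum_sub_notin_const //; case: (eqVneq #|z| t) => [->//|/ht ->]; by rewrite !mulr0.
Qed.

(** For [a] outside [x], the new subsets of [a |: x] are those containing [a]. Their total over all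
    such [a] is [- t * ssum h x]: in the sum of [dn h w = 0] over [w \subset x], the part with [a]
    inside [x] counts each [t]-subset of [x] once per element. *)
Lemma dn_ssum t h x : supp t h -> (forall z, dn h z = 0) ->
  dn (ssum h) x = (n%:R - #|x|%:R - t%:R) * ssum h x.
Proof.
move=> ht dh.
have split_a a : a \notin x -> ssum h (a |: x) =
    ssum h x + \sum_(w : {set 'I_n} | w \subset x) h (a |: w).
  move=> ax; rewrite /ssum (bigID (fun z => a \in z)) /= addrC; congr (_ + _).
    by apply: eq_bigl => z; rewrite -subsetD1 setU1K.
  rewrite reindex_setU1; apply: eq_bigl => w.
  rewrite subUset sub1set setU11 /=.
  by rewrite -subsetD1 setU1K.
have tE : t%:R * ssum h x =
    \sum_(a in x) \sum_(w : {set 'I_n} | (w \subset x) && (a \notin w)) h (a |: w).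
  rewrite mulr_sumr.
  transitivity (\sum_(z : {set 'I_n} | z \subset x) \sum_(a in x | a \in z) h z).
    apply: eq_bigr => z zx.
    transitivity (\sum_(a in z) h z).
      by rewrite sum_in_const; case: (eqVneq #|z| t) => [->//|/ht ->]; rewrite !mulr0.
    by apply: eq_bigl => a; case: (boolP (a \in z)) => [/(subsetP zx) ->//|]; rewrite andbF.
  rewrite (exchange_big_dep (mem x)) /=; last by move=> ? ? _ /andP[].
  apply: eq_bigr => a ax.
  transitivity (\sum_(z : {set 'I_n} | (z \subset x) && (a \in z)) h z).
    by apply: eq_bigl => z; rewrite ax.
  by rewrite reindex_setU1; apply: eq_bigl => w; rewrite subUset sub1set ax.
rewrite {1}/dn; under eq_bigr => a ax do rewrite split_a //.
rewrite big_split /= sum_notin_const [RHS]mulrBl tE; congr (_ + _).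
apply/eqP; rewrite -addr_eq0; apply/eqP.
transitivity (\sum_(w : {set 'I_n} | w \subset x) dn h w); last by rewrite big1.
rewrite exchange_big /= (exchange_big_dep (fun w => w \subset x)) /=; last by move=> ? ? _ /andP[].
rewrite -big_split /=; apply: eq_bigr => w wx.
rewrite /dn [RHS](bigID (mem x)) /= addrC; congr (_ + _); apply: eq_bigl => a.
  by rewrite wx andbC.
by case: (boolP (a \in x)) => ax; rewrite ?andbF // (contraNN (subsetP wx a) ax).
Qed.

Lemma ssum_lt t h x : supp t h -> (#|x| < t)%N -> ssum h x = 0.
Proof.
move=> ht xt; apply: big1 => z /subset_leq_card zx; apply: ht.
by rewrite neq_ltn (leq_ltn_trans zx xt).
Qed.

Lemma ssum_eq t h x : supp t h -> #|x| = t -> ssum h x = h x.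
Proof.
move=> ht xt; rewrite /ssum (bigD1 x) //= big1 ?addr0 // => z /andP[zx zNx].
apply: ht; rewrite -xt neq_ltn proper_card // properEneq zNx; exact: zx.
Qed.

(** On level [j + 1] the functions [up f] and [ssum f] agree, so this is injectivity of [up]. *)
Lemma ssum_inj j f : (2 * j < n)%N -> supp j f ->
  (forall x, #|x| = j.+1 -> ssum f x = 0) -> forall x, f x = 0.
Proof.
move=> jn fj sf; apply: (up_inj jn fj) => x.
case: (eqVneq #|x| j.+1) => [xj|xj].
  transitivity (up (ssum f) x); last by rewrite (up_ssum _ fj) sf // mulr0.
  apply: eq_bigr => a ax; rewrite (ssum_eq fj) //.
  by move: xj; rewrite (cardsD1 a x) ax => -[].
apply: big1 => a ax; apply: fj; move: xj; rewrite (cardsD1 a x) ax.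
by rewrite add1n eqSS.
Qed.

(** Both sides count pairs of a [t]-set [x] above [z] and an element of [x] outside [z], weighted by
    [h x]. *)
Lemma sum_supset t h z : supp t h ->
  (t%:R - #|z|%:R) * (\sum_(x : {set 'I_n} | z \subset x) h x) =
  \sum_(a | a \notin z) \sum_(x : {set 'I_n} | a |: z \subset x) h x.
Proof.
move=> ht; rewrite mulr_sumr (exchange_big_dep (fun x => z \subset x)) /=; last first.
  by move=> a x _; rewrite subUset => /andP[].
apply: eq_bigr => x zx; transitivity (\sum_(a in x | a \notin z) h x).
  by rewrite sum_sub_notin_const //; case: (eqVneq #|x| t) => [->//|/ht ->]; rewrite !mulr0.
by apply: eq_bigl => a; rewrite subUset sub1set zx andbT andbC.
Qed.

Lemma sum_supset_eq t h z : supp t h -> #|z| = t -> \sum_(x : {set 'I_n} | z \subset x) h x = h z.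
Proof.
move=> ht zt; rewrite (bigD1 z) //= big1 ?addr0 // => x /andP[zx xNz].
apply: ht; rewrite -zt neq_ltn orbC proper_card // properEneq eq_sym xNz; exact: zx.
Qed.

Lemma sum_supset_dn t h z : supp t h -> #|z|.+1 = t ->
  \sum_(x : {set 'I_n} | z \subset x) h x = dn h z.
Proof.
move=> ht zt; have := sum_supset z ht; rewrite -zt -natr1 addrAC subrr add0r mul1r => ->.
by apply: eq_bigr => a az; apply: sum_supset_eq ht _; rewrite cardsU1 az -zt.
Qed.

(** Downward induction on [#|z|] from [t - 1], where the sum is [dn h z]; below that, [sum_supset]
    expresses a nonzero multiple of the sum through larger sets. *)
Lemma harmonic_supset t h z : supp t h -> (forall z, dn h z = 0) -> (#|z| < t)%N ->
  \sum_(x : {set 'I_n} | z \subset x) h x = 0.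
Proof.
move=> ht dh; have [k] := ubnP (t - #|z|); elim: k z => // k IH z kz zt.
case: (eqVneq #|z|.+1 t) => [e|ne]; first by rewrite (sum_supset_dn ht).
have : (t%:R - #|z|%:R) * \sum_(x : {set 'I_n} | z \subset x) h x = 0.
  by rewrite (sum_supset _ ht); apply: big1 => a az; apply: IH; rewrite cardsU1 az; lia.
by move/eqP; rewrite mulf_eq0 subr_eq0 eqr_nat (gtn_eqF zt) => /eqP.
Qed.

(** Induction on [i] from [t], where the claim is [harmonic_supset]. A nonzero multiple of the sum
    on level [i + 1] is the sum of [dn (ssum h)] over the sets above [z] on level [i], and [dn_ssum]
    makes that a multiple of the sum on level [i]. *)
Lemma harmonic_perp t h i z : supp t h -> (forall z, dn h z = 0) -> (#|z| < t)%N -> (t <= i)%N ->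
  \sum_(x : {set 'I_n} | #|x| == i) ssum h x * (z \subset x)%:R = 0.
Proof.
move=> ht dh zt; elim: i => [|i IH] ti; first lia.
case: (eqVneq t i.+1) => [ei|ni].
  rewrite -[RHS](harmonic_supset ht dh zt) -ei big_mkcond [RHS]big_mkcond /=.
  apply: eq_bigr => x _; case: (eqVneq #|x| t) => [e|/ht ->]; last by case: ifP.
  by rewrite (ssum_eq ht e); case: (z \subset x); rewrite ?mulr1 ?mulr0.
have key : (i.+1%:R - #|z|%:R) *
      (\sum_(x : {set 'I_n} | #|x| == i.+1) ssum h x * (z \subset x)%:R) =
    \sum_(x : {set 'I_n} | #|x| == i) dn (ssum h) x * (z \subset x)%:R.
  transitivity (\sum_(x : {set 'I_n})
      \sum_(a | (a \in x) && [&& #|x| == i.+1, z \subset x & a \notin z]) ssum h x).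
    rewrite mulr_sumr big_mkcond; apply: eq_bigr => x _.
    case: (eqVneq #|x| i.+1) => [xi|_]; last by rewrite big_pred0 // => a; rewrite andbF.
    case: (boolP (z \subset x)) => zx /=; last first.
      by rewrite !mulr0 big_pred0 // => a; rewrite andbF.
    by rewrite mulr1 sum_sub_notin_const // xi.
  rewrite (exchange_setU1 (fun x _ => ssum h x)
    (fun x a => [&& #|x| == i.+1, z \subset x & a \notin z])) [RHS]big_mkcond.
  apply: eq_bigr => x _; transitivity (\sum_(a | (a \notin x) && ((#|x| == i) && (z \subset x)))
     ssum h (a |: x)).
    apply: eq_bigl => a; case: (boolP (a \in x)) => //= ax.
    by rewrite cardsU1 ax add1n eqSS -subsetD1 setU1K.
  case: (#|x| == i); last by rewrite big_pred0 // => a; rewrite andbF.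
  case: (z \subset x); last by rewrite mulr0 big_pred0 // => a; rewrite !andbF.
  by rewrite mulr1; apply: eq_bigl => a; rewrite !andbT.
have : (i.+1%:R - #|z|%:R) *
    (\sum_(x : {set 'I_n} | #|x| == i.+1) ssum h x * (z \subset x)%:R) = 0.
  rewrite key; transitivity (\sum_(x : {set 'I_n} | #|x| == i)
      (n%:R - i%:R - t%:R) * (ssum h x * (z \subset x)%:R)).
    by apply: eq_bigr => x /eqP xi; rewrite (dn_ssum _ ht dh) xi mulrA.
  by rewrite -mulr_sumr IH ?mulr0 //; lia.
move/eqP; rewrite mulf_eq0 subr_eq0 eqr_nat => /orP[|/eqP //]; lia.
Qed.

Definition toggle x a := if a \in x then x :\ a else a |: x.

Lemma in_toggle x a b : (b \in toggle x a) = (b == a) (+) (b \in x).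
Proof.
by rewrite /toggle; case: ifP => ax; rewrite !inE; case: (eqVneq b a) => //= ->; rewrite ax.
Qed.

Lemma toggle_inj x : injective (toggle x).
Proof.
move=> a b /setP/(_ a); rewrite !in_toggle eqxx.
by case: eqVneq => // _; case: (a \in x).
Qed.

Lemma hamming1E x y : (hamming n x y == 1%N) = (y \in toggle x @: 'I_n).
Proof.
apply/cards1P/imsetP => -[a].
  move=> /setP e; exists a => //; apply/setP => b; have := e b.
  by rewrite in_toggle !inE => <-; case: (b \in x); case: (b \in y).
move=> _ ->; exists a; apply/setP => b.
by rewrite !inE in_toggle; case: (b \in x); case: (b == a).
Qed.

(** Toggling an element of [x] contributes to [up], toggling one outside [x] to [dn]. *)
Lemma sum_hamming1 g x : \sum_y (hamming n x y == 1%N)%:R * g y = up g x + dn g x.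
Proof.
transitivity (\sum_(y in toggle x @: 'I_n) g y).
  rewrite [RHS]big_mkcond; apply: eq_bigr => y _.
  by rewrite hamming1E; case: ifP; rewrite ?mul1r ?mul0r.
rewrite big_imset; last by move=> a b _ _ /toggle_inj.
rewrite /= (bigID (mem x)) /=; congr (_ + _).
  by apply: eq_big => [a|a]; rewrite ?inE // => ax; rewrite /toggle ax.
by apply: eq_big => [a|a]; rewrite ?inE // => ax; rewrite /toggle (negbTE ax).
Qed.

End SetFunctions.

(** * Row vectors as functions *)

Section FunRow.
Variables (R : nzRingType) (X : finType).
Implicit Types (P Q : pred X).

(** [vfun] is the case of the ball; a general predicate treats levels and balls alike. *)
Definition fun_row P (v : 'rV[R]_#|{: {x : X | P x}}|) (x : X) : R :=
  if @insub X P {x : X | P x} x is Some y then v ord0 (enum_rank y) else 0.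

Definition row_fun P (f : X -> R) : 'rV[R]_#|{: {x : X | P x}}| :=
  \row_j f (val (enum_val j)).

Definition kernel_mx P Q (K : X -> X -> R) : 'M[R]_(#|{: {x : X | P x}}|, #|{: {x : X | Q x}}|) :=
  \matrix_(i, j) K (val (enum_val i)) (val (enum_val j)).

Lemma fun_row_val P (v : 'rV[R]_#|{: {x : X | P x}}|) j : fun_row v (val (enum_val j)) = v ord0 j.
Proof. by rewrite /fun_row valK enum_valK. Qed.

Lemma fun_row_out P (v : 'rV[R]_#|{: {x : X | P x}}|) x : ~~ P x -> fun_row v x = 0.
Proof. by move=> Px; rewrite /fun_row insubN. Qed.

Lemma fun_row_inj P (v w : 'rV[R]_#|{: {x : X | P x}}|) :
  (forall x, P x -> fun_row v x = fun_row w x) -> v = w.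
Proof.
move=> vw; apply/rowP => j; rewrite -!fun_row_val; apply: vw; exact: valP.
Qed.

Lemma row_funK P f x : fun_row (row_fun P f) x = if P x then f x else 0.
Proof.
case: ifPn => Px; last exact: fun_row_out.
by rewrite /fun_row insubT mxE enum_rankK.
Qed.

Lemma sum_fun_row P (v : 'rV[R]_#|{: {x : X | P x}}|) (G : X -> R) :
  \sum_j v ord0 j * G (val (enum_val j)) = \sum_x fun_row v x * G x.
Proof.
rewrite (reindex (@enum_rank {x : X | P x})) /=; last exact/onW_bij/enum_rank_bij.
rewrite [RHS](bigID P) /= [X in _ + X]big1 ?addr0 => [|x Px]; last first.
  by rewrite fun_row_out // mul0r.
rewrite [RHS](reindex_omap val (insub : X -> option {x : X | P x})) /=; last first.
  by move=> x Px; rewrite insubT.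
by apply: eq_big => [y|y _]; rewrite ?valK ?eqxx ?andbT ?(valP y) // /fun_row valK enum_rankK.
Qed.

Lemma fun_row_mul P Q K (v : 'rV[R]_#|{: {x : X | P x}}|) x :
  fun_row (v *m kernel_mx P Q K) x = if Q x then \sum_y fun_row v y * K y x else 0.
Proof.
case: ifPn => Qx; last exact: fun_row_out.
rewrite -sum_fun_row {1}/fun_row insubT mxE; apply: eq_bigr => j _.
by rewrite mxE enum_rankK.
Qed.

Lemma fun_rowD P (v w : 'rV[R]_#|{: {x : X | P x}}|) x :
  fun_row (v + w) x = fun_row v x + fun_row w x.
Proof. by rewrite /fun_row; case: insubP => [y _ _|_]; rewrite ?mxE ?addr0. Qed.

Lemma fun_rowZ P a (v : 'rV[R]_#|{: {x : X | P x}}|) x : fun_row (a *: v) x = a * fun_row v x.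
Proof. by rewrite /fun_row; case: insubP => [y _ _|_]; rewrite ?mxE ?mulr0. Qed.

Lemma fun_row0 P x : fun_row (0 : 'rV[R]_#|{: {x : X | P x}}|) x = 0.
Proof. by rewrite /fun_row; case: insubP => [y _ _|_]; rewrite ?mxE. Qed.

End FunRow.

(** * Harmonic functions on a single level *)

Section Harmonic.
Variables (R : realFieldType) (n t : nat).
Hypothesis tn : (2 * t <= n)%N.
Implicit Types (x z : {set 'I_n}).

Lemma dn_supp (h : {set 'I_n} -> R) z : supp t h -> #|z|.+1 != t -> dn h z = 0.
Proof. by move=> ht zt; apply: big1 => a az; apply: ht; rewrite cardsU1 az. Qed.

Definition down_mx := kernel_mx (fun x => #|x| == t) (fun z => #|z|.+1 == t)
  (fun x z => (z \subset x)%:R : R).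

Lemma down_mx_ker v : v *m down_mx = 0 <-> forall z, dn (fun_row v) z = 0.
Proof.
have hv : supp t (fun_row v) by move=> x; exact: fun_row_out.
have e z : #|z|.+1 == t -> fun_row (v *m down_mx) z = dn (fun_row v) z.
  move=> zt; rewrite fun_row_mul zt -(sum_supset_dn hv (eqP zt)) [RHS]big_mkcond.
  by apply: eq_bigr => x _; case: ifP; rewrite ?mulr1 ?mulr0.
split=> [v0 z|dv]; last by apply: fun_row_inj => z zt; rewrite e // dv fun_row0.
case: (boolP (#|z|.+1 == t)) => zt; last exact: dn_supp.
by rewrite -e // v0 fun_row0.
Qed.

(* For [t = 0] no set has [#|z|.+1 == t], so the matrix has no columns. *)
Lemma down_mx_rank : \rank down_mx = #|{: {z : {set 'I_n} | #|z|.+1 == t}}|.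
Proof.
rewrite -mxrank_tr; apply/eqP; apply: inj_row_free => w w0.
have -> : w = 0 :> 'rV_ _; last by [].
(* The transposed matrix sums over subsets, so [ssum_inj] on level [t - 1] applies; [z0] names that
   level without a subtraction. *)
apply: fun_row_inj => z0 /eqP z0t; rewrite fun_row0.
have hw : supp #|z0| (fun_row w).
  by move=> z zz0; apply: fun_row_out; rewrite -z0t eqSS.
apply: (ssum_inj _ hw) => [|x xz]; first lia.
have xt : #|x| == t by rewrite xz z0t.
transitivity (fun_row (w *m down_mx^T) x); last by rewrite w0 fun_row0.
have -> : down_mx^T = kernel_mx (fun z => #|z|.+1 == t) (fun x => #|x| == t)
    (fun z x => (z \subset x)%:R : R) by apply/matrixP => i j; rewrite !mxE.
rewrite fun_row_mul xt [LHS]big_mkcond.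
by apply: eq_bigr => z _; case: ifP; rewrite ?mulr1 ?mulr0.
Qed.

Lemma card_level k : #|{: {x : {set 'I_n} | #|x| == k}}| = 'C(n, k).
Proof.
by rewrite card_sig -[in RHS](card_ord n) -card_draws; apply: eq_card => x; rewrite !inE.
Qed.

Lemma harmonic_rank : \rank (kermx down_mx) = bdiff n t.
Proof.
rewrite mxrank_ker down_mx_rank card_level; case: t => [|k] /=.
  by rewrite bin0 card_sig eq_card0.
by congr (_ - _)%N; rewrite -card_level.
Qed.

End Harmonic.

(** * Eigenspaces of the ball *)

Section Coefficients.
Variables (R : realType) (m : nat) (lam : R).

(* For [k > m] the denominator is 0, and so is [radial_coef k]. *)
Definition radial_coef k : R := (jacobi (krawb R m) k).[lam] / (m ^_ k)%:R.

Lemma radial_coef0 : radial_coef 0 = 1.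
Proof. by rewrite /radial_coef /= hornerC ffactn0 divr1. Qed.

(** This is the eigenvalue equation on level [t + k]: the first term comes from [up], the second
    from [dn], and the latter is cut off at the outermost level [s = r - t]. *)
Lemma radial_coef_rec s k : (s <= m)%N -> root (jacobi (krawb R m) s.+1) lam -> (k <= s)%N ->
  k%:R * radial_coef k.-1 + (if (k < s)%N then (m%:R - k%:R) * radial_coef k.+1 else 0) =
  lam * radial_coef k.
Proof.
move=> sm /rootP ps ks; have km := leq_trans ks sm.
case: k ks km => [_ _|k ks km].
  rewrite radial_coef0 mul0r add0r subr0 mulr1; case: ltnP => [s0|].
    by rewrite /radial_coef /= hornerX ffactn1 mulrC divfK // pnatr_eq0; lia.
  by rewrite leqn0 => /eqP s0; move: ps; rewrite s0 /= hornerX => ->.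
have rec : (jacobi (krawb R m) k.+2).[lam] = lam * (jacobi (krawb R m) k.+1).[lam] -
    k.+1%:R * (m%:R - k%:R) * (jacobi (krawb R m) k).[lam].
  rewrite jacobiSS hornerD hornerN hornerZ hornerM hornerX /krawb -[k.+1%:R]natr1; ring.
have u0 : (m ^_ k)%:R != 0 :> R by rewrite pnatr_eq0 -lt0n ffact_gt0; lia.
have mk : (m - k)%:R = m%:R - k%:R :> R by rewrite natrB //; lia.
have mk0 : m%:R - k%:R != 0 :> R by rewrite -mk pnatr_eq0; lia.
have f1 : (m ^_ k.+1)%:R = (m ^_ k)%:R * (m%:R - k%:R) :> R by rewrite ffactnSr natrM mk.
rewrite /radial_coef f1 -pred_Sn; case: ltnP => [ks'|sk].
  have mk1 : (m - k.+1)%:R = m%:R - k.+1%:R :> R by rewrite natrB //; lia.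
  have mk10 : m%:R - k.+1%:R != 0 :> R by rewrite -mk1 pnatr_eq0; lia.
  rewrite ffactnSr natrM mk1 f1 rec; set c := m%:R - k.+1%:R in mk10 *; field.
  by rewrite mk10 u0 mk0.
(* On the outermost level the vanishing of [p_(s+1)] at [lam] replaces the missing term. *)
have e : s = k.+1 by lia.
move: ps; rewrite e rec => /eqP; rewrite subr_eq0 => /eqP ps.
rewrite addr0 [RHS]mulrA ps; field.
by rewrite u0 mk0.
Qed.

End Coefficients.

Section Ball.
Variables (R : realType) (n r : nat).
Hypothesis hr : (2 * r <= n)%N.
Implicit Types (x z : {set 'I_n}) (h : {set 'I_n} -> R).

Lemma LambdaE t lam : lam \in Lambda R n r t = root (jacobi (krawb R (n - 2 * t)) (r - t).+1) lam.
Proof.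
rewrite unfold_in /Lambda /root jacobi_kraw !mulf_eq0 signr_eq0 pnatr_eq0 gtn_eqF ?fact_gt0 //.
Qed.

Definition radial t lam (i : nat) : R := radial_coef (n - 2 * t) lam (i - t).

Definition ext_mx t lam := kernel_mx (fun x => #|x| == t) (fun x => (#|x| <= r)%N)
  (fun z x => radial t lam #|x| * (z \subset x)%:R : R).

(** The row space consists of the radial extensions of harmonic functions on level [t]; the
    generated form is square, so its size does not depend on [t]. *)
Definition eigen_mx t lam : 'M[R]_#|{: ballT n r}| :=
  <<kermx (down_mx R n t) *m ext_mx t lam>>%MS.

Lemma fun_row_ext t lam (w : 'rV_#|{: {x : {set 'I_n} | #|x| == t}}|) x :
  fun_row (w *m ext_mx t lam) x =
  if (#|x| <= r)%N then radial t lam #|x| * ssum (fun_row w) x else 0.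
Proof.
rewrite fun_row_mul; case: ifP => // _; rewrite /ssum mulr_sumr [RHS]big_mkcond.
apply: eq_bigr => z _; case: ifP; rewrite ?mulr1 ?mulr0 //.
by rewrite mulrC.
Qed.

Lemma eigen_mxP t lam (v : 'rV_#|{: ballT n r}|) : reflect
  (exists h, [/\ supp t h, forall z, dn h z = 0 & forall x, vfun R n r v x =
     if (#|x| <= r)%N then radial t lam #|x| * ssum h x else 0])
  (v <= eigen_mx t lam)%MS.
Proof.
rewrite genmxE; apply: (iffP idP) => [/submxP[w ->]|[h [ht dh vh]]].
  exists (fun_row (w *m kermx (down_mx R n t))); split.
  - by move=> x; exact: fun_row_out.
  - by apply/down_mx_ker; rewrite -mulmxA mulmx_ker mulmx0.
  - by move=> x; rewrite mulmxA -fun_row_ext.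
pose w := row_fun (fun x => #|x| == t) h.
have wh x : fun_row w x = h x by rewrite row_funK; case: eqVneq => // /ht.
have -> : v = w *m ext_mx t lam.
  apply: fun_row_inj => x xr; rewrite fun_row_ext.
  have := vh x; rewrite /vfun -/(fun_row v x) xr => ->; congr (_ * _).
  by apply: eq_bigr => z _; rewrite wh.
apply: submxMr; apply/sub_kermxP/down_mx_ker => z.
by rewrite -(dh z); apply: eq_bigr => a _; rewrite wh.
Qed.

(** [radial] is 1 on level [t], so restriction to that level undoes the extension and no dimension
    is lost. *)
Lemma eigen_mx_rank t lam : (t <= r)%N -> \rank (eigen_mx t lam) = bdiff n t.
Proof.
move=> tr; rewrite mxrank_gen mxrankMfree ?harmonic_rank //; first lia.
apply: inj_row_free => w w0; apply: fun_row_inj => x /eqP xt; rewrite fun_row0.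
have wt : supp t (fun_row w) by move=> y; exact: fun_row_out.
have := fun_row_ext lam w x; rewrite w0 fun_row0 xt tr /radial subnn radial_coef0 mul1r.
by rewrite (ssum_eq wt).
Qed.

Lemma vfun_mul_adjB v x : (#|x| <= r)%N ->
  vfun R n r (v *m adjB R n r) x = up (vfun R n r v) x + dn (vfun R n r v) x.
Proof.
move=> xr; rewrite -sum_hamming1.
have -> : adjB R n r = kernel_mx _ _ (fun y x => (hamming n y x == 1%N)%:R : R) by [].
rewrite [LHS]fun_row_mul xr; apply: eq_bigr => y _; rewrite mulrC; congr (_ * _).
by rewrite /hamming setUC.
Qed.

Lemma eigen_mx_sub t lam : (t <= r)%N -> lam \in Lambda R n r t ->
  (eigen_mx t lam <= eigenspace (adjB R n r) lam)%MS.
Proof.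
move=> tr; rewrite LambdaE => lamt; apply/rV_subP => v /eigen_mxP[h [ht dh vh]].
apply/eigenspaceP; apply: fun_row_inj => x xr; rewrite fun_rowZ.
have := vfun_mul_adjB v xr; rewrite /vfun -!/(fun_row _ _) => ->.
rewrite -!/(vfun R n r v) [fun_row v x]vh xr.
have -> : up (vfun R n r v) x = radial t lam #|x|.-1 * ((#|x|%:R - t%:R) * ssum h x).
  rewrite -(up_ssum x ht) mulr_sumr; apply: eq_bigr => a ax; rewrite vh.
  by move: xr; rewrite (cardsD1 a x) ax add1n => xr; rewrite ltnW.
(* If [#|x| = r], every [a |: x] lies outside the ball, where [vfun] is 0; this is the cut-off case
   of the recurrence. *)
have -> : dn (vfun R n r v) x = (if (#|x| < r)%N then radial t lam #|x|.+1 else 0)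
    * ((n%:R - #|x|%:R - t%:R) * ssum h x).
  rewrite -(dn_ssum x ht dh) mulr_sumr; apply: eq_bigr => a ax; rewrite vh.
  by rewrite cardsU1 ax add1n; case: ifP => //; rewrite mul0r.
case: (ltnP #|x| t) => [xt|tx]; first by rewrite (ssum_lt ht) // !mulr0 addr0.
have e1 : (r - t <= n - 2 * t)%N by lia.
have e2 : (#|x| - t <= r - t)%N by lia.
(* With [m = n - 2t] and [k = #|x| - t], the factor [n - #|x| - t] of [dn] is [m - k]. *)
have /(congr1 (fun c => c * ssum h x)) := radial_coef_rec e1 lamt e2.
rewrite /= -[in RHS]mulrA => <-.
rewrite [RHS]mulrDl; congr (_ + _).
  by rewrite natrB // /radial (_ : #|x|.-1 - t = (#|x| - t).-1)%N; [ring | lia].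
rewrite /radial (_ : (#|x| - t < r - t)%N = (#|x| < r)%N); last lia.
case: ifP => _; last by rewrite !mul0r.
rewrite subSn // !natrB ?natrM //; [ring | lia].
Qed.

Lemma eigen_mx_low t lam v x : (v <= eigen_mx t lam)%MS -> (#|x| < t)%N -> vfun R n r v x = 0.
Proof.
by move=> /eigen_mxP[h [ht _ ->]] xt; rewrite (ssum_lt ht xt) mulr0; case: ifP.
Qed.

Lemma eigen_mx_determined t lam v w : (t <= r)%N ->
  (v <= eigen_mx t lam)%MS -> (w <= eigen_mx t lam)%MS ->
  (forall x, #|x| = t -> vfun R n r v x = vfun R n r w x) -> v = w.
Proof.
move=> tr /eigen_mxP[h [ht _ vh]] /eigen_mxP[k [kt _ wk]] vw.
have hk z : h z = k z.
  case: (eqVneq #|z| t) => [zt|zt]; last by rewrite ht // kt.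
  have := vw z zt; rewrite vh wk zt tr /radial subnn radial_coef0 !mul1r.
  by rewrite (ssum_eq ht) // (ssum_eq kt).
apply: fun_row_inj => x xr; have := vh x; have := wk x; rewrite xr.
rewrite /vfun -!/(fun_row _ _) => -> ->; congr (_ * _).
by apply: eq_bigr => z _.
Qed.

Lemma eigen_mx_inV t lam v i : (v <= eigen_mx t lam)%MS -> (t <= i)%N -> (i <= r)%N ->
  inV R n i t (vfun R n r v).
Proof.
move=> /eigen_mxP[h [ht dh vh]] ti ir; split.
  exists (fun z => radial t lam i * h z) => x xi; rewrite vh xi ir /ssum mulr_sumr.
  rewrite big_mkcond [RHS]big_mkcond; apply: eq_bigr => z _.
  case: (ltnP t #|z|) => tz; last by case: ifP; rewrite ?mulr1 ?mulr0.
  by rewrite ht ?mulr0 ?if_same // gtn_eqF.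
move=> z zt; transitivity (\sum_(x : {set 'I_n} | #|x| == i)
    radial t lam i * (ssum h x * (z \subset x)%:R)).
  by apply: eq_bigr => x /eqP xi; rewrite vh xi ir mulrA.
by rewrite -mulr_sumr (harmonic_perp ht dh zt ti) mulr0.
Qed.

Lemma eigen_mx_span t lam h : (t <= r)%N -> inV R n t t h ->
  exists2 v, (v <= eigen_mx t lam)%MS & forall x, #|x| = t -> vfun R n r v x = h x.
Proof.
move=> tr [_ hperp].
pose h' x := if #|x| == t then h x else 0.
have ht : supp t h' by move=> x xt; rewrite /h' (negbTE xt).
(* Orthogonality tested on sets of size [t - 1] says that the truncation [h'] is harmonic. *)
have dh z : dn h' z = 0.
  case: (eqVneq #|z|.+1 t) => zt; last exact: (dn_supp ht zt).
  rewrite -(sum_supset_dn ht zt) -[RHS](hperp z); last by rewrite -zt.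
  rewrite big_mkcond [RHS]big_mkcond; apply: eq_bigr => x _; rewrite /h'.
  by case: (z \subset x); case: eqP; rewrite ?mulr1 ?mulr0.
pose g x := radial t lam #|x| * ssum h' x.
exists (row_fun (fun x => (#|x| <= r)%N) g).
  by apply/eigen_mxP; exists h'; split=> // x; rewrite [LHS]row_funK.
move=> x xt; rewrite [LHS]row_funK xt tr /g xt /radial subnn radial_coef0 mul1r.
by rewrite (ssum_eq ht xt) /h' xt eqxx.
Qed.

Lemma eigen_mx_eq0 t lam (v : 'rV[R]_#|{: ballT n r}|) : (t <= r)%N ->
  (v <= eigen_mx t lam)%MS -> (forall x, #|x| = t -> vfun R n r v x = 0) -> v = 0.
Proof.
move=> tr vW v0; apply: (eigen_mx_determined tr vW (sub0mx _ _)) => x xt.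
rewrite v0 //; apply/esym; exact: (@fun_row0 _ _ (fun x => (#|x| <= r)%N)).
Qed.

(** Downward induction on [j]. The vanishing below level [j] makes the sum direct: a member of
    [eigen_mx j lam] lying in the sum of the later spaces vanishes on level [j], hence is 0. *)
Lemma eigen_mx_sum_rank lam j : (j <= r.+1)%N ->
  \rank (\sum_(j <= t < r.+1 | lam \in Lambda R n r t) eigen_mx t lam)%MS =
    (\sum_(j <= t < r.+1 | lam \in Lambda R n r t) bdiff n t)%N
  /\ forall v x, (v <= \sum_(j <= t < r.+1 | lam \in Lambda R n r t) eigen_mx t lam)%MS ->
    (#|x| < j)%N -> vfun R n r v x = 0.
Proof.
move=> jr; have [k kE] : exists k, (j + k = r.+1)%N by exists (r.+1 - j)%N; lia.
elim: k j jr kE => [|k IH] j jr kE.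
  rewrite !big_geq; try lia; rewrite mxrank0; split=> // v x; rewrite submx0 => /eqP -> _.
  exact: (@fun_row0 _ _ (fun x => (#|x| <= r)%N)).
have [||IHr IHv] := IH j.+1; try lia.
have jr' : (j <= r)%N by lia.
rewrite !(@big_ltn_cond _ _ _ j r.+1) //; case: ifP => lamj; last first.
  by split=> // v x hv xj; apply: IHv => //; rewrite ltnS ltnW.
split.
  rewrite mxrank_disjoint_sum ?IHr ?eigen_mx_rank //; apply/eqP/rowV0P => v.
  rewrite sub_capmx => /andP[vj vs].
  by apply: (eigen_mx_eq0 jr' vj) => x xj; rewrite (IHv _ _ vs) ?xj.
move=> v x /sub_addsmxP[[u1 u2] /= ->] xj.
have e (a b : 'rV[R]_#|{: ballT n r}|) : vfun R n r (a + b) x = vfun R n r a x + vfun R n r b x.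
  exact: fun_rowD.
rewrite e (eigen_mx_low (submxMl _ _) xj) (IHv _ _ (submxMl _ _)) ?addr0 //.
exact: leqW.
Qed.

(** * Dimension count on the ball *)

Lemma leq_bin_pred t : (2 * t.+1 <= n)%N -> ('C(n, t) < 'C(n, t.+1))%N.
Proof.
move=> tn; have := mul_bin_left n t; have : (0 < 'C(n, t))%N by rewrite bin_gt0; lia.
nia.
Qed.

Lemma bdiff_gt0 t : (t <= r)%N -> (0 < bdiff n t)%N.
Proof.
by case: t => // t tr; rewrite /= subn_gt0 leq_bin_pred //; lia.
Qed.

(** The sum telescopes; binomial coefficients increase up to the middle, so the truncated
    subtractions are exact. *)
Lemma sum_bdiff i : (i <= r)%N -> (\sum_(t < i.+1) bdiff n t = 'C(n, i))%N.
Proof.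
elim: i => [|i IH] ir; first by rewrite big_ord_recl big_ord0 bin0.
rewrite big_ord_recr IH ?(ltnW ir) //= subnKC // ltnW // leq_bin_pred //; lia.
Qed.

Lemma card_ball : #|{: ballT n r}| = (\sum_(t < r.+1) (r - t).+1 * bdiff n t)%N.
Proof.
transitivity (\sum_(i < r.+1) 'C(n, i))%N.
  rewrite card_sig -sum1_card.
  rewrite (partition_big (fun x => inord #|x| : 'I_r.+1) xpredT) //=.
  apply: eq_bigr => i _; rewrite -(card_level n i) card_sig -sum1_card.
  apply: eq_bigl => x; rewrite !inE; apply/andP/eqP => [[xr /eqP <-]|xi].
    by rewrite inordK.
  by rewrite xi -ltnS ltn_ord; split=> //; apply/eqP/val_inj; rewrite /= inordK.
(* Each [t] contributes once for every level from [t] to [r], hence [r - t + 1] times. *)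
transitivity (\sum_(i < r.+1) \sum_(t < r.+1 | (t <= i)%N) bdiff n t)%N.
  apply: eq_bigr => i _; rewrite -sum_bdiff -1?ltnS //.
  by rewrite (big_ord_widen r.+1 (bdiff n)) ?ltn_ord.
rewrite (exchange_big_dep xpredT) //=; apply: eq_bigr => t _.
rewrite -subSn -1?ltnS // -sum_nat_const_nat (@big_geq_mkord _ _ _ t r.+1 xpredT (fun=> bdiff n t)).
by [].
Qed.

Lemma ball_spectrum : diagonalizable (adjB R n r) /\ forall lam,
  \rank (eigenspace (adjB R n r) lam) = (\sum_(t < r.+1 | lam \in Lambda R n r t) bdiff n t)%N.
Proof.
have roots (t : 'I_r.+1) : exists s : seq R,
    [/\ uniq s, size s = (r - t).+1 & forall lam, lam \in s -> lam \in Lambda R n r t].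
  have [|s [sU ss] sr] := @kraw_roots R (n - 2 * t) (r - t).+1.
    by have := ltn_ord t; lia.
  by exists s; split.
have [s sP] := fin_all_exists roots.
apply: (@eigen_count _ _ _ 'I_r.+1 (fun t => Lambda R n r t) s (fun t => bdiff n t)).
- by move=> t; case: (sP t).
- by move=> t a; case: (sP t) => _ _; apply.
- by rewrite card_ball; apply: leq_sum => t _; case: (sP t) => _ ->.
(* At [j = 0] the sum contains all the spaces for [lam], and it lies in the eigenspace. *)
move=> lam; have [] := @eigen_mx_sum_rank lam 0 isT; rewrite !big_mkord => <- _.
apply: mxrankS; apply/sumsmx_subP => t lamt; apply: eigen_mx_sub lamt.
by rewrite -ltnS.
Qed.

End Ball.

Theorem theorem1p7 (R : realType) (n r : nat) (hr : (2 * r <= n)%N) :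
  (* (1) and (3) *)
  (exists W : nat -> R -> 'M[R]_#|{: ballT n r}|,
    forall (t : nat) (lam : R), (t <= r)%N -> lam \in Lambda R n r t ->
      [/\ (W t lam <= eigenspace (adjB R n r) lam)%MS,
          \rank (W t lam) = bdiff n t,
          (forall v : 'rV[R]_#|{: ballT n r}|, (v <= W t lam)%MS ->
             (forall x : {set 'I_n}, (#|x| < t)%N -> vfun R n r v x = 0) /\
             (forall i : nat, (t <= i)%N -> (i <= r)%N -> inV R n i t (vfun R n r v))),
          (forall h : {set 'I_n} -> R, inV R n t t h ->
             exists2 v : 'rV[R]_#|{: ballT n r}|, (v <= W t lam)%MS &
               forall x : {set 'I_n}, #|x| = t -> vfun R n r v x = h x) &
          (forall v w : 'rV[R]_#|{: ballT n r}|, (v <= W t lam)%MS -> (w <= W t lam)%MS ->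
             (forall x : {set 'I_n}, #|x| = t -> vfun R n r v x = vfun R n r w x) -> v = w)]) /\
  (* (2) *)
  (forall lam : R,
    (eigenvalue (adjB R n r) lam <-> exists2 t : nat, (t <= r)%N & lam \in Lambda R n r t) /\
    (eigenvalue (adjB R n r) lam ->
       mup lam (char_poly (adjB R n r)) = (\sum_(t < r.+1 | lam \in Lambda R n r t) bdiff n t)%N)).
Proof.
split.
  exists (@eigen_mx R n r) => t lam tr lamt; split.
  - exact: eigen_mx_sub.
  - exact: eigen_mx_rank.
  - move=> v vW; split=> [x|i]; [exact: eigen_mx_low vW | exact: eigen_mx_inV vW].
  - by move=> h; apply: eigen_mx_span.
  - by move=> v w; apply: eigen_mx_determined.
have [diagA rankA] := ball_spectrum R hr.
move=> lam; split=> [|_]; last by rewrite mup_char_poly_diagonalizable.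
(* The rank is a sum of positive terms [bdiff n t], so it is nonzero as soon as one [t] occurs. *)
rewrite /eigenvalue -mxrank_eq0 rankA sum_nat_eq0 negb_forall; split.
  by case/existsP=> t; rewrite negb_imply => /andP[lamt _]; exists t; rewrite // -ltnS.
case=> t tr lamt; have tr' : (t < r.+1)%N by [].
by apply/existsP; exists (Ordinal tr'); rewrite /= lamt -lt0n (bdiff_gt0 hr).
Qed.
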